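(* Let $S$ be a set, $R$ a supertropical semiring, and $f_1,\dots,f_k\in\mathrm{Fun}(S,R)$. Then for every positive integer $m$, $$\Big(\sum_{i=1}^k f_i\Big)^m=\sum_{i=1}^k f_i^m .$$
   Context: All semirings are commutative (in both operations), with zero $0_R$ and unit $1_R$. A supertropical semiring is a triple $(R,\mathcal G_0,\nu)$ where $R$ is a semiring, $\mathcal G_0=\mathcal G\cup\{0_R\}$ is a semiring ideal of $R$ (the ghost ideal), and $\nu:R\to\mathcal G_0$ (written $a^\nu=\nu(a)$) is a semiring homomorphism with $\nu^2=\nu$ (where $\mathcal G_0$ is a semiring with unit $\nu(1_R)$), such that: $a+a=a^\nu$ for all $a$; $a+b\in\{a,b\}$ whenever $a^\nu\ne b^\nu$; and $a+b=a^\nu$ whenever $a^\nu=b^\nu$. $\mathrm{Fun}(S,R)$ is the semiring of all functions $S\to R$ under pointwise addition and multiplication. *)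

(* Defs.v *)
From HB Require Import structures.
From mathcomp Require Import all_boot all_algebra.
From mathcomp Require Import boolp classical_sets functions.

Set Implicit Arguments.
Unset Strict Implicit.
Unset Printing Implicit Defensive.

Import GRing.Theory.
Local Open Scope ring_scope.

Definition semiring_ideal (R : comPzSemiRingType) (I : set R) : Prop :=
  [/\ I 0,
      forall a b, I a -> I b -> I (a + b)
    & forall r a, I a -> I (r * a)].

(* [ghost] is the ghost ideal G_0, hence contains 0. That [nu] is a semiring
   homomorphism into G_0 is spelled out on elements of R, the unit
   of the semiring G_0 being [nu 1] (in general [nu 1] differs from 1, so [nu]
   is not an {rmorphism R -> R}). *)
HB.mixin Record isSupertropical R of GRing.ComPzSemiRing R := {
  ghost : set R;
  nu : R -> R;
  ghost_ideal : semiring_ideal ghost;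
  nu_ghost : forall a : R, ghost (nu a);
  nu1_unit : forall g : R, ghost g -> nu 1 * g = g;
  nu0 : nu 0 = 0;
  nuD : {morph nu : a b / a + b};
  nuM : {morph nu : a b / a * b};
  nuK : forall a : R, nu (nu a) = nu a;
  addrr_nu : forall a : R, a + a = nu a;
  addr_bipotent : forall a b : R, nu a <> nu b -> a + b = a \/ a + b = b;
  addr_nu_eq : forall a b : R, nu a = nu b -> a + b = nu a
}.

#[short(type="supertropicalType")]
HB.structure Definition Supertropical :=
  {R of GRing.ComPzSemiRing R & isSupertropical R}.

(* The library equips S -> R with a multiplication only when R is a ring; the
   alias [Fun] carries the pointwise semiring structure instead. *)
Definition Fun (S : Type) (R : comPzSemiRingType) : Type := S -> R.

Section FunSemiRing.
Variables (S : Type) (R : comPzSemiRingType).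

HB.instance Definition _ := GRing.Nmodule.copy (Fun S R) (S -> R).

Definition fun_one : Fun S R := fun=> 1.
Definition fun_mul (f g : Fun S R) : Fun S R := fun x => f x * g x.

Let fun_mulA : associative fun_mul.
Proof. by move=> f g h; apply/funext => x; exact: mulrA. Qed.

Let fun_mulC : commutative fun_mul.
Proof. by move=> f g; apply/funext => x; exact: mulrC. Qed.

Let fun_mul1 : left_id fun_one fun_mul.
Proof. by move=> f; apply/funext => x; exact: mul1r. Qed.

Let fun_mulDl : left_distributive fun_mul +%R.
Proof. by move=> f g h; apply/funext => x; exact: mulrDl. Qed.

Let fun_mul0 : left_zero 0 fun_mul.
Proof. by move=> f; apply/funext => x; exact: mul0r. Qed.

HB.instance Definition _ := GRing.Nmodule_isComPzSemiRing.Build (Fun S R)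
  fun_mulA fun_mulC fun_mul1 fun_mulDl fun_mul0.

Lemma Fun_zeroE x : (0 : Fun S R) x = 0.
Proof. by []. Qed.

Lemma Fun_oneE x : (1 : Fun S R) x = 1.
Proof. by []. Qed.

Lemma Fun_addE (f g : Fun S R) x : (f + g) x = f x + g x.
Proof. by []. Qed.

Lemma Fun_mulE (f g : Fun S R) x : (f * g) x = f x * g x.
Proof. by []. Qed.

End FunSemiRing.

(* Main.v *)
Require Import Defs.
From mathcomp Require Import all_boot all_algebra.
From mathcomp Require Import boolp.
Import GRing.Theory.
Local Open Scope ring_scope.

(** Raising to a positive power is additive on a supertropical semiring, hence
    pointwise on functions, hence on finite sums.  For two elements [a] and [b]
    there are two cases.  If [nu a = nu b], then both [(a + b) ^+ m] and
    [a ^+ m + b ^+ m] are the ghost [nu (a ^+ m)].  Otherwise one summand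
    absorbs the other, say [a + b = a], and absorption passes to powers:
    [a ^+ m + b ^+ m = a ^+ m].

    The delicate point is that [nu a <> nu b] does not give
    [nu (a ^+ m) <> nu (b ^+ m)], because multiplication need not be
    cancellative; bipotence can therefore not be applied to the powers
    themselves.  Absorption survives all the same, by distributivity alone
    (lemma [absorb_exp]). *)

(** The relation [x + y = x] is transitive and compatible with multiplication.
    Hence [a ^+ m.+2] absorbs [a * b ^+ m.+1] by induction, which in turn
    absorbs [b ^+ m.+2].  The exponent [0] is excluded because [1 + 1] may
    differ from [1]. *)
Lemma absorb_exp (R : comPzSemiRingType) (a b : R) (m : nat) :
  (0 < m)%N -> a + b = a -> a ^+ m + b ^+ m = a ^+ m.
Proof.
case: m => // m _ ab; elim: m => [|m IHm]; first by rewrite !expr1.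
have lower : a * b ^+ m.+1 + b ^+ m.+2 = a * b ^+ m.+1.
  by rewrite (exprS b m.+1) -mulrDl ab.
have upper : a ^+ m.+2 + a * b ^+ m.+1 = a ^+ m.+2.
  by rewrite (exprS a m.+1) -mulrDr IHm.
by rewrite -{1}upper -addrA lower upper.
Qed.

(** The exponent is a successor because [nu 1] is in general not [1]. *)
Lemma nuXS (R : supertropicalType) (a : R) (m : nat) :
  nu (a ^+ m.+1) = nu a ^+ m.+1.
Proof. by elim: m => [|m IHm]; rewrite ?expr1 // exprS nuM IHm -exprS. Qed.

Lemma supertropical_exprD (R : supertropicalType) (a b : R) (m : nat) :
  (0 < m)%N -> (a + b) ^+ m = a ^+ m + b ^+ m.
Proof.
move=> m_gt0; have [nu_ab|nu_ab] := pselect (nu a = nu b).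
  by case: m m_gt0 => // m _; rewrite !addr_nu_eq // !nuXS // nu_ab.
have [ab|ab] := addr_bipotent a b nu_ab; first by rewrite ab absorb_exp.
by rewrite ab addrC absorb_exp // addrC.
Qed.

Lemma Fun_expE (S : Type) (R : comPzSemiRingType) (f : Fun S R) (m : nat)
    (x : S) : (f ^+ m) x = f x ^+ m.
Proof. by elim: m => // m IHm; rewrite !exprS Fun_mulE IHm. Qed.

Theorem corollary3p28 (S : Type) (R : supertropicalType) (k : nat)
    (f : 'I_k -> Fun S R) (m : nat) (hm : (0 < m)%N) :
  (\sum_(i < k) f i) ^+ m = \sum_(i < k) f i ^+ m.
Proof.
apply: (big_morph (fun g : Fun S R => g ^+ m)) => [g h|].
  apply/funext => x.
  by rewrite Fun_addE !Fun_expE Fun_addE supertropical_exprD.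
by rewrite expr0n eqn0Ngt hm.
Qed.
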